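(* Let $p,q$ be positive integers and $d>1$ a divisor of $pq$. If $d$ divides $\gcd(p,q)$, then $H(p,q,d)$ is a line digraph, i.e. there is a digraph $G'$ such that $H(p,q,d)$ is isomorphic to $L(G')$.
   Context: For integers $a\le b$, $[a,b]=\{c\in\mathbb{Z}: a\le c\le b\}$. Digraphs may have loops and multiple arcs. For positive integers $p,q$, every $a\in[0,pq-1]$ is written uniquely as $a=iq+j$ with $i\in[0,p-1]$, $j\in[0,q-1]$, denoted $a=(i,j)_{p,q}$. For a divisor $d>1$ of $pq$, the digraph $H(p,q,d)$ has vertex set $[0,pq/d-1]$, where vertex $k$ represents the block $[kd,kd+d-1]$; for each $i\in[0,p-1]$, $j\in[0,q-1]$ there is one arc from the vertex whose block contains $iq+j$ to the vertex whose block contains $(q-1-j)p+(p-1-i)$ (arcs counted with multiplicity). The line digraph $L(G)$ of a digraph $G$ has the arcs of $G$ as vertices, with an arc from $(u,v)$ to $(v,w)$ whenever these are arcs of $G$. *)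

(* Defs.v *)
From mathcomp Require Import all_boot zify.

Set Implicit Arguments.
Unset Strict Implicit.
Unset Printing Implicit Defensive.

(* Finite digraphs; loops and multiple arcs are allowed. *)
Record digraph := Digraph {
  vertex : finType;
  arc : finType;
  src : arc -> vertex;
  tgt : arc -> vertex }.

Arguments src {_} _.
Arguments tgt {_} _.

Definition isomorphic (G1 G2 : digraph) : Prop :=
  exists (f : vertex G1 -> vertex G2) (g : arc G1 -> arc G2),
    [/\ bijective f, bijective g &
        forall a, src (g a) = f (src a) /\ tgt (g a) = f (tgt a)].

(* Parallel arcs of G are distinct vertices of its line digraph. *)
Definition line_digraph (G : digraph) : digraph :=
  @Digraph (arc G) {ab : arc G * arc G | tgt ab.1 == src ab.2}
    (fun ab => (val ab).1) (fun ab => (val ab).2).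

Definition is_line_digraph (G : digraph) : Prop :=
  exists G' : digraph, isomorphic G (line_digraph G').

Section OTIS.

Variables p q d : nat.

Definition arc_tail (i : 'I_p) (j : 'I_q) : nat := i * q + j.

Definition arc_head (i : 'I_p) (j : 'I_q) : nat :=
  (q - 1 - j) * p + (p - 1 - i).

Lemma arc_tail_lt i j : arc_tail i j < p * q.
Proof. rewrite /arc_tail; have := ltn_ord i; have := ltn_ord j; nia. Qed.

Lemma arc_head_lt i j : arc_head i j < p * q.
Proof. rewrite /arc_head; have := ltn_ord i; have := ltn_ord j; nia. Qed.

Hypothesis d_dvd : d %| p * q.

Lemma block_index_lt a : a < p * q -> a %/ d < p * q %/ d.
Proof.
move=> lt_a; have pq_gt0 : 0 < p * q by apply: leq_ltn_trans lt_a.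
by rewrite ltn_divLR ?divnK // (dvdn_gt0 pq_gt0).
Qed.

Definition vertex_of_block a (lt_a : a < p * q) : 'I_(p * q %/ d) :=
  Ordinal (block_index_lt lt_a).

Lemma vertex_of_blockP a (lt_a : a < p * q) (k : 'I_(p * q %/ d)) :
  (vertex_of_block lt_a == k) = (k * d <= a <= k * d + d - 1).
Proof.
have pq_gt0 : 0 < p * q by apply: leq_ltn_trans lt_a.
have d_gt0 := dvdn_gt0 pq_gt0 d_dvd.
rewrite -val_eqE /= eqn_leq -ltnS ltn_divLR // leq_divRL // andbC.
by congr andb; rewrite mulSn; lia.
Qed.

(* The digraph H(p, q, d). *)
Definition otis_digraph : digraph :=
  @Digraph 'I_(p * q %/ d) ('I_p * 'I_q)%type
    (fun ij => vertex_of_block (arc_tail_lt ij.1 ij.2))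
    (fun ij => vertex_of_block (arc_head_lt ij.1 ij.2)).

End OTIS.

(* Main.v *)
Require Import Defs.
From mathcomp Require Import all_boot.
From mathcomp Require Import zify.

(** Put [p = p' d] and [q = q' d]. The arc [(i, j)] goes from
    [i q' + j %/ d] to [(q - 1 - j) p' + (p' - 1 - i %/ d)]. Hence a pair of
    vertices [u, v] determines [i = u %/ q'] and [q - 1 - j = v %/ p'], so there
    are no parallel arcs, and there is an arc from [u] to [v] exactly when [u]
    and [v] yield the same pair [(i %/ d, j %/ d)]: this pair is the common
    endpoint of [u] and [v] seen as arcs of [G']. *)

(* The vertices of [G'] are sets of vertices of [G], a finite type into which
   the labels in use embed: a label [x] is encoded by its fibre under [t]. *)
Lemma is_line_digraph_of_labels (G : digraph) (T : eqType)
    (h t : vertex G -> T) :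
    injective (fun a : Defs.arc G => (src a, tgt a)) ->
    (forall u v, h u = t v <-> exists a : Defs.arc G, src a = u /\ tgt a = v) ->
  is_line_digraph G.
Proof.
move=> inj_arc arcP.
pose fibre x := [set v | x == t v].
pose G' := @Digraph {set vertex G} (vertex G)
  (fun v => fibre (t v)) (fun u => fibre (h u)).
(* Labels outside the image of [t] all share the empty fibre; this is harmless, as the fibre of
   [t v] contains [v]. *)
have matchP u v : (fibre (h u) == fibre (t v)) = (h u == t v).
  apply/eqP/eqP => [/setP/(_ v)|-> //].
  by rewrite !inE eqxx => /eqP.
have match_arc (a : Defs.arc G) : @tgt G' (src a) == @src G' (tgt a).
  by rewrite /= matchP; apply/eqP/arcP; exists a.
pose g (a : Defs.arc G) : Defs.arc (line_digraph G') :=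
  exist _ (src a, tgt a) (match_arc a).
exists G', id, g; split; [by exists id | | by []].
have inj_g : injective g by move=> a b /(congr1 val)/inj_arc.
have surj_g (b : Defs.arc (line_digraph G')) : exists a, g a == b.
  case: b => -[u v] /= uv; have /arcP[a [su tv]] : h u = t v.
    by apply/eqP; rewrite -matchP.
  by exists a; rewrite -val_eqE /= su tv.
have pickK b : g (xchoose (surj_g b)) = b by exact/eqP/(xchooseP (surj_g b)).
by exists (fun b => xchoose (surj_g b)) => // a; apply: inj_g.
Qed.

(** Reversing an interval of [m] blocks of length [d] reverses the order of the blocks and each
    block internally, so the new remainder is [d - 1 - i %% d]. *)
Lemma divn_rev (m d i : nat) : i < m * d ->
  (m * d - 1 - i) %/ d = m - 1 - i %/ d.
Proof.
move=> lt_i; have d_gt0 : 0 < d by case: d lt_i; rewrite ?muln0.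
have lt_im : i %/ d < m by rewrite ltn_divLR.
have lt_r := ltn_pmod i d_gt0.
have -> : m * d - 1 - i = (m - 1 - i %/ d) * d + (d - 1 - i %% d).
  move: (divn_eq i d) lt_im lt_r; move: (i %/ d) (i %% d) => e r -> lt_em lt_r.
  (* This removes truncated subtraction from under the product with [d]. *)
  have [k ->] : exists k, m = e + 1 + k by exists (m - 1 - e); lia.
  have -> : e + 1 + k - 1 - e = k by lia.
  by rewrite !mulnDl; lia.
rewrite divnMDl // [X in _ + X]divn_small ?addn0 //.
by rewrite -subnDA ltn_subrL add1n d_gt0.
Qed.

Lemma divn_quot_rem (m x y : nat) : y < m ->
  (x * m + y) %/ m = x /\ (x * m + y) %% m = y.
Proof.
move=> lt_y; rewrite modnMDl modn_small // divnMDl ?divn_small ?addn0 //.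
exact: leq_ltn_trans lt_y.
Qed.

Theorem theorem3p2 (p q d : nat) (p_gt0 : 0 < p) (q_gt0 : 0 < q)
    (d_gt1 : 1 < d) (d_dvd : d %| p * q) :
  d %| gcdn p q -> is_line_digraph (otis_digraph d_dvd).
Proof.
rewrite dvdn_gcd => /andP[/dvdnP[p' Dp] /dvdnP[q' Dq]].
have d_gt0 := ltnW d_gt1.
have p'_gt0 : 0 < p' by case: p' Dp p_gt0 => // ->.
have q'_gt0 : 0 < q' by case: q' Dq q_gt0 => // ->.
have nE : p * q %/ d = p * q' by rewrite Dq mulnA mulnK.
(* Both forms of the vertex count serve: [p * q'] bounds [u %/ q'] by [p], and [q * p'] bounds
   [v %/ p'] by [q]. *)
have nE' : p * q' = q * p' by rewrite Dp Dq; nia.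
pose G := otis_digraph d_dvd.
have srcE (a : Defs.arc G) : val (src a) = a.1 * q' + a.2 %/ d.
  rewrite /= /arc_tail; set i := val a.1; set j := val a.2.
  by rewrite Dq mulnA divnMDl.
have tgtE (a : Defs.arc G) :
    val (tgt a) = (q - 1 - a.2) * p' + (p' - 1 - a.1 %/ d).
  rewrite /= /arc_head; have := ltn_ord a.1.
  set i := val a.1; set j := val a.2; rewrite Dp => lt_i.
  by rewrite mulnA divnMDl // divn_rev.
have lt_j (j : 'I_q) : j %/ d < q' by rewrite ltn_divLR // -Dq.
have lt_i (i : 'I_p) : i %/ d < p' by rewrite ltn_divLR // -Dp.
have src_qr (a : Defs.arc G) := divn_quot_rem q' a.1 (a.2 %/ d) (lt_j _).
have revK n x : x < n -> n - 1 - (n - 1 - x) = x by lia.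
have lt_rev n x : x < n -> n - 1 - x < n by lia.
have tgt_qr (a : Defs.arc G) :=
  divn_quot_rem p' (q - 1 - a.2) (p' - 1 - a.1 %/ d) (lt_rev _ _ (lt_i _)).
(* The first map reads [(i %/ d, j %/ d)] off a tail, the second off a head, undoing both
   reversals. *)
apply: (@is_line_digraph_of_labels G _
  (fun u => (val u %/ q' %/ d, val u %% q'))
  (fun v => (p' - 1 - val v %% p', (q - 1 - val v %/ p') %/ d))).
  move=> a b eq_ab.
  have := congr1 (fun uv => val uv.1 %/ q') eq_ab.
  have := congr1 (fun uv => val uv.2 %/ p') eq_ab.
  rewrite [_.1]/= [_.2]/= !srcE !tgtE (src_qr a).1 (src_qr b).1.
  rewrite (tgt_qr a).1 (tgt_qr b).1 => eq_j eq_i.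
  case: a b eq_i eq_j {eq_ab} => [i j] [i' j'] /= eq_i eq_j.
  congr pair; apply: val_inj => //=.
  by have := ltn_ord j; have := ltn_ord j'; lia.
move=> u v; split=> [[eq_i eq_j] | [a [<- <-]]]; last first.
  rewrite srcE tgtE (src_qr a).1 (src_qr a).2 (tgt_qr a).1 (tgt_qr a).2.
  by rewrite !revK.
have lt_u : val u %/ q' < p by rewrite ltn_divLR // -nE ltn_ord.
have lt_v : val v %/ p' < q by rewrite ltn_divLR // -nE' -nE ltn_ord.
have lt_w := lt_rev _ _ lt_v.
(* The quotients of [u] and [v] fix the arc. The remainders then agree by the labels: [eq_j] settles
   the tail, [eq_i] the head. *)
exists (Ordinal lt_u, Ordinal lt_w); split; apply: val_inj.
  by rewrite srcE /= -eq_j -divn_eq.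
rewrite tgtE /= eq_i [RHS](divn_eq _ p').
by rewrite !revK ?ltn_pmod.
Qed.
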